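(* Let $f=2-x^{-1}-y^{-1}\in\mathbb{Z}[\mathbb{H}]$. Then the topological entropy of $\alpha_f$ is $\mathsf{h}(\alpha_f)=\log2$, so that $\Sigma_2=\{0,1\}^{\mathbb{H}}$ is an equal-entropy symbolic cover of $X_f$.
   Context: $\mathbb{H}$ is the discrete Heisenberg group of upper triangular unipotent integer $3\times3$ matrices, with the standard generators $x,y$ (ones in position $(1,2)$, resp. $(2,3)$) and central element $z=xyx^{-1}y^{-1}$; it is amenable. $\mathbb{T}=\mathbb{R}/\mathbb{Z}$. The left and right shift actions on $\mathbb{T}^{\mathbb{H}}$ are $(\lambda^\gamma x)_{\gamma'}=x_{\gamma^{-1}\gamma'}$ and $(\rho^\gamma x)_{\gamma'}=x_{\gamma'\gamma}$; for $f=\sum_\gamma f_\gamma\gamma\in\mathbb{Z}[\mathbb{H}]$, $\rho^f=\sum_\gamma f_\gamma\rho^\gamma$. The principal algebraic action $(X_f,\alpha_f)$ is given by $X_f=\ker\rho^f\subset\mathbb{T}^{\mathbb{H}}$ and $\alpha_f=$ the restriction of $\lambda$ to $X_f$; $\mathsf{h}(\alpha_f)$ is its topological entropy as an action of the amenable group $\mathbb{H}$. A subshift $\Sigma\subset\{0,\dots,N-1\}^{\mathbb{H}}$ (closed and left-shift-invariant, $N\ge2$) has topological entropy $\mathsf{h}(\Sigma)=\lim_{n\to\infty}\frac{\log|P_{F_n}(\Sigma)|}{|F_n|}$, where $(F_n)$ is a Følner sequence in $\mathbb{H}$ and $P_F\colon\Sigma\to\{0,\dots,N-1\}^F$ is the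 coordinate projection. $\Sigma$ is a symbolic cover of $X_f$ if there is a left-shift-equivariant continuous surjective map $\xi\colon\Sigma\to X_f$; it is an equal-entropy symbolic cover if moreover the left shift actions of $\mathbb{H}$ on $\Sigma$ and on $X_f$ have the same topological entropy. *)

(* Defs.v *)
From HB Require Import structures.
From mathcomp Require Import all_boot all_order all_algebra.
From mathcomp Require Import finmap generic_quotient ring_quotient archimedean.
From mathcomp Require Import all_classical all_reals all_analysis.
From mathcomp Require Import freeg.
From mathcomp Require Import ring.

Set Implicit Arguments.
Unset Strict Implicit.
Unset Printing Implicit Defensive.

Import Order.TTheory GRing.Theory Num.Theory.
Import numFieldNormedType.Exports.

Local Open Scope classical_set_scope.
Local Open Scope ring_scope.

Definition unitriangular (A : 'M[int]_3) : bool :=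
  [forall i : 'I_3, forall j : 'I_3, (j <= i)%N ==> (A i j == (i == j)%:R)].

Record heisenberg := Heisenberg {
  heis_mx :> 'M[int]_3;
  _ : unitriangular heis_mx }.

HB.instance Definition _ := [isSub for heis_mx].
HB.instance Definition _ := [Choice of heisenberg by <:].

Lemma mulmx3E (A B : 'M[int]_3) i j :
  (A *m B) i j = A i 0 * B 0 j + A i 1 * B 1 j + A i 2 * B 2 j.
Proof.
rewrite mxE !big_ord_recl big_ord0 addr0 addrA.
by congr (_ + A i _ * B _ j + A i _ * B _ j); exact: val_inj.
Qed.

Lemma ord3P (P : 'I_3 -> Prop) : P 0 -> P 1 -> P 2 -> forall i, P i.
Proof.
move=> P0 P1 P2 [[|[|[|//]]] i3].
- by rewrite (_ : Ordinal i3 = 0)//; exact: val_inj.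
- by rewrite (_ : Ordinal i3 = 1)//; exact: val_inj.
- by rewrite (_ : Ordinal i3 = 2)//; exact: val_inj.
Qed.

Lemma unitriangularP (A : 'M[int]_3) :
  reflect ([/\ A 0 0 = 1, A 1 1 = 1 & A 2 2 = 1] /\
           [/\ A 1 0 = 0, A 2 0 = 0 & A 2 1 = 0]) (unitriangular A).
Proof.
apply: (iffP forallP) => [uA|[[A00 A11 A22] [A10 A20 A21]]].
  have uAE (i j : 'I_3) : (j <= i)%N -> A i j = (i == j)%:R.
    by move: (uA i) => /forallP/(_ j)/implyP H /H/eqP.
  by split; split; rewrite uAE.
apply: ord3P; apply/forallP; apply: ord3P => //=;
by rewrite ?(A00, A11, A22, A10, A20, A21).
Qed.

Lemma unitriangular1 : unitriangular 1%:M.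
Proof. by apply/unitriangularP; split; split; rewrite mxE. Qed.

Lemma unitriangularM (A B : 'M[int]_3) :
  unitriangular A -> unitriangular B -> unitriangular (A *m B).
Proof.
move=> /unitriangularP[[a00 a11 a22] [a10 a20 a21]].
move=> /unitriangularP[[b00 b11 b22] [b10 b20 b21]].
by apply/unitriangularP; split; split;
  rewrite mulmx3E ?(a00,a11,a22,a10,a20,a21,b00,b11,b22,b10,b20,b21); ring.
Qed.

(* (1 + N)^-1 = 1 - N + N^2 since N^3 = 0 *)
Definition unitri_inv (A : 'M[int]_3) : 'M[int]_3 :=
  let N := A - 1%:M in 1%:M - N + N *m N.

Lemma unitri_invE (A : 'M[int]_3) i j :
  unitri_inv A i j = (i == j)%:R - (A i j - (i == j)%:R)
    + ((A i 0 - (i == 0)%:R) * (A 0 j - (0 == j)%:R)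
    + (A i 1 - (i == 1)%:R) * (A 1 j - (1 == j)%:R)
    + (A i 2 - (i == 2)%:R) * (A 2 j - (2 == j)%:R)).
Proof. by rewrite /unitri_inv mxE mulmx3E !mxE. Qed.

Lemma unitriangularV (A : 'M[int]_3) :
  unitriangular A -> unitriangular (unitri_inv A).
Proof.
move=> /unitriangularP[[a00 a11 a22] [a10 a20 a21]].
by apply/unitriangularP; split; split;
  rewrite unitri_invE /= ?(a00,a11,a22,a10,a20,a21); ring.
Qed.

Lemma unitri_mulV (A : 'M[int]_3) : unitriangular A -> unitri_inv A *m A = 1%:M.
Proof.
move=> /unitriangularP[[a00 a11 a22] [a10 a20 a21]].
by apply/matrixP; apply: ord3P; apply: ord3P;
  rewrite mulmx3E !unitri_invE !mxE /= ?(a00,a11,a22,a10,a20,a21); ring.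
Qed.

Lemma unitri_mulrV (A : 'M[int]_3) : unitriangular A -> A *m unitri_inv A = 1%:M.
Proof.
move=> /unitriangularP[[a00 a11 a22] [a10 a20 a21]].
by apply/matrixP; apply: ord3P; apply: ord3P;
  rewrite mulmx3E !unitri_invE !mxE /= ?(a00,a11,a22,a10,a20,a21); ring.
Qed.

Definition heis_one := Heisenberg unitriangular1.

Definition heis_mul (A B : heisenberg) :=
  Heisenberg (unitriangularM (valP A) (valP B)).

Definition heis_inv (A : heisenberg) := Heisenberg (unitriangularV (valP A)).

Lemma heis_mulA : associative heis_mul.
Proof. by move=> A B C; apply: val_inj; rewrite /= mulmxA. Qed.

Lemma heis_mul1 : left_id heis_one heis_mul.
Proof. by move=> A; apply: val_inj; rewrite /= mul1mx. Qed.

Lemma heis_mulr1 : right_id heis_one heis_mul.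
Proof. by move=> A; apply: val_inj; rewrite /= mulmx1. Qed.

Lemma heis_mulV : left_inverse heis_one heis_inv heis_mul.
Proof. by move=> A; apply: val_inj; rewrite /= unitri_mulV// (valP A). Qed.

Lemma heis_mulrV : right_inverse heis_one heis_inv heis_mul.
Proof. by move=> A; apply: val_inj; rewrite /= unitri_mulrV// (valP A). Qed.

HB.instance Definition _ := isGroup.Build heisenberg
  heis_mulA heis_mul1 heis_mulr1 heis_mulV heis_mulrV.

Lemma unitriangular_delta (i j : 'I_3) :
  (i < j)%N -> unitriangular (1%:M + delta_mx i j).
Proof.
move=> ij; apply/forallP => k; apply/forallP => l; apply/implyP => lk.
rewrite !mxE; case: (k =P i) => [ki|_] /=; last by rewrite addr0.
case: (l =P j) => [lj|_] /=; last by rewrite addr0.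
by move: lk; rewrite ki lj leqNgt ij.
Qed.

Definition gen_x : heisenberg := Heisenberg (@unitriangular_delta 0 1 isT).
Definition gen_y : heisenberg := Heisenberg (@unitriangular_delta 1 2 isT).

(* T = R/Z, with the quotient group structure and the quotient topology *)
Definition integers (R : realType) : zmodClosed R :=
  GRing.ZmodClosed.clone R (@Num.int_num_subdef R) _.

Definition circle (R : realType) : Type :=
  quotient_topology (Quotient.quot (integers R)).

HB.instance Definition _ (R : realType) := Topological.on (circle R).
HB.instance Definition _ (R : realType) :=
  GRing.Zmodule.copy (circle R) (Quotient.quot (integers R)).

Definition left_shift (G : groupType) (A : Type) (g : G) (x : {ptws G -> A}) :
  {ptws G -> A} := fun h => x (g^-1 * h)%g.

Definition right_shift (G : groupType) (A : Type) (g : G) (x : G -> A) :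
  G -> A := fun h => x (h * g)%g.

(* [{freeg G / int}] is the additive group of the integral group ring Z[G]; the
   ring multiplication plays no role here. *)
Definition rho (R : realType) (G : groupType) (f : {freeg G / int})
    (x : G -> circle R) : G -> circle R :=
  \sum_(g <- dom f) right_shift g x *~ coeff g f.

Definition principal (R : realType) (G : groupType) (f : {freeg G / int}) :
  set {ptws G -> circle R} := [set x | rho f x = 0].

Lemma rho_left_shift (R : realType) (G : groupType) (f : {freeg G / int})
    (g : G) (x : G -> circle R) :
  rho f (left_shift g x) = left_shift g (rho f x).
Proof.
rewrite /rho; apply/funext => h; rewrite /left_shift.
elim: (dom f) => [|k s IH]; first by rewrite !big_nil.
rewrite !big_cons /=.
rewrite !fctE IH; congr (_ + _).
have mulzE (y : G -> circle R) (m : int) l : (y *~ m) l = y l *~ m.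
  by case: m => n; rewrite ?NegzE ?mulrNz -?pmulrn ?fctE ?natmulfctE.
by rewrite !mulzE /right_shift mulgA.
Qed.

Lemma principal_shift (R : realType) (G : groupType) (f : {freeg G / int})
    (g : G) (x : {ptws G -> circle R}) :
  principal f x -> principal f (left_shift g x).
Proof. by rewrite /principal /= rho_left_shift => ->. Qed.

Definition alpha (R : realType) (G : groupType) (f : {freeg G / int})
    (g : G) (x : principal (R:=R) f) : principal (R:=R) f :=
  exist _ (left_shift g (val x)) (mem_set (principal_shift g (set_valP x))).

(* Right Folner sequences, |F_n g /\ F_n| / |F_n| --> 0 (symmetric
   difference), are used throughout; accordingly the joins are taken over
   the covers [g U], g in F, so that for the left shift action on a subshift
   they refine the information on the coordinates in F itself. (Replacing F by
   its inverse turns this into the convention of left Folner sequences and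
   joins of the covers [g^-1 U].) *)
Definition folner (R : realType) (G : groupType) (F : nat -> {fset G}) : Prop :=
  (forall n, F n != fset0) /\
  forall g : G,
    (fun n => let Fg := [fset (h * g)%g | h in F n]%fset in
       #|` ((F n `\` Fg) `|` (Fg `\` F n))%fset|%:R / #|` F n|%:R : R) @ \oo
    --> (0 : R).

Definition open_cover (X : topologicalType) (C : set (set X)) : Prop :=
  (forall U, C U -> open U) /\ \bigcup_(U in C) U = setT.

Definition cover_join (G : groupType) (X : Type) (act : G -> X -> X)
    (F : {fset G}) (C : set (set X)) : set (set X) :=
  [set \bigcap_(g in [set` F]) (act g @` c g) |
    c in [set c : G -> set X | forall g, g \in F -> C (c g)]].

(* log N(C), with N(C) the least cardinality of a subcover of C
   (+oo if C has no finite subcover) *)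
Definition log_cover_number (R : realType) (X : Type) (C : set (set X)) :
    \bar R :=
  ereal_inf [set (ln (n%:R : R))%:E | n in
    [set n : nat | exists D : set (set X),
       [/\ D `<=` C, (D #= `I_n)%card & \bigcup_(U in D) U = setT]]].

(* For X compact and F Folner the limit exists by the Ornstein-Weiss lemma. *)
Definition topological_entropy (R : realType) (G : groupType)
    (X : topologicalType) (F : nat -> {fset G}) (act : G -> X -> X) : \bar R :=
  ereal_sup [set limn (fun n =>
      (log_cover_number R (cover_join act (F n) C) * (#|` F n|%:R^-1)%:E)%E) |
    C in @open_cover X].

Record subshift (G : groupType) (N : nat) := Subshift {
  subshift_set :> set {ptws G -> discrete_topology 'I_N};
  subshift_alphabet : (1 < N)%N;
  subshift_closed : closed subshift_set;
  subshift_invariant : forall (g : G) (x : {ptws G -> discrete_topology 'I_N}),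
    subshift_set x -> subshift_set (left_shift g x) }.

Definition shift_action (G : groupType) (N : nat) (S : subshift G N)
    (g : G) (x : S) : S :=
  exist _ (left_shift g (val x)) (mem_set (subshift_invariant g (set_valP x))).

Definition coord_proj (G : groupType) (N : nat) (F : {fset G})
    (x : {ptws G -> discrete_topology 'I_N}) : {ffun F -> 'I_N} :=
  [ffun g : F => x (val g)].

Definition subshift_entropy (R : realType) (G : groupType) (N : nat)
    (F : nat -> {fset G}) (S : subshift G N) : \bar R :=
  limn (fun n =>
    (ln (#|` fset_set (coord_proj (F n) @` S)|%:R : R) / #|` F n|%:R)%:E).

Definition symbolic_cover (R : realType) (G : groupType) (N : nat)
    (f : {freeg G / int}) (S : subshift G N) : Prop :=
  exists xi : S -> principal (R:=R) f,
    [/\ continuous xi, range xi = setT &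
        forall g x, xi (shift_action g x) = alpha g (xi x)].

Definition equal_entropy_symbolic_cover (R : realType) (G : groupType)
    (N : nat) (F : nat -> {fset G}) (f : {freeg G / int}) (S : subshift G N) :
    Prop :=
  symbolic_cover R f S /\
  subshift_entropy R F S = topological_entropy R F (@alpha R G f).

Definition full_shift (G : groupType) (N : nat) (N1 : (1 < N)%N) :
    subshift G N :=
  Subshift N1 closedT (fun _ _ _ => I).

(* Main.v *)
(* Let avg v h = (v (h x^-1) + v (h y^-1)) / 2, so that rho^f = 2 (1 - avg) and,
   formally, f^-1 = sum_n avg^n / 2. A coupling argument shows that
   (1 - z) avg^n has norm O(n^(-1/2)) on bounded functions; as z is central,
   (1 - z)^4 avg^n is O(n^-2), hence v |-> (1 - z)^4 f^-1 v mod 1 is a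
   continuous equivariant map from {0,1}^H to X_f.

   It is onto. H is graded by the degree a + b, and both x^-1 and y^-1 lower
   the degree by one. Given u in X_f, one solves (1 - z)^4 u' = u together with
   f u' = 0 on large degrees, level by level, and lifts u' to a real function
   L vanishing in low degrees such that f L takes its values in {0,1} (this is
   the toppling of a directed sandpile). The configuration f L is mapped
   approximately to u, and compactness concludes.

   Hence h(alpha_f) <= log 2. Conversely, solving 2 u(h) = u(h x^-1) + u(h y^-1)
   level by level with a free choice of the half on a finite set F yields 2^|F|
   points of X_f, any two of which differ by exactly 1/2 somewhere in F. *)

Require Import Defs.
From mathcomp Require Import all_boot all_order all_algebra.
From mathcomp Require Import finmap all_classical all_reals all_analysis.
From mathcomp Require Import freeg.
From mathcomp Require Import generic_quotient ring_quotient archimedean.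
From mathcomp Require Import ring lra zify.

Set Implicit Arguments.
Unset Strict Implicit.
Unset Printing Implicit Defensive.

Import Order.TTheory GRing.Theory Num.Theory.
Import numFieldNormedType.Exports.

Local Open Scope classical_set_scope.
Local Open Scope ring_scope.

(** * Coordinates (a, b, c) and the degree a + b on the Heisenberg group *)

Definition heis_a (g : heisenberg) : int := heis_mx g 0 1.
Definition heis_b (g : heisenberg) : int := heis_mx g 1 2.
Definition heis_c (g : heisenberg) : int := heis_mx g 0 2.

Lemma heis_eq (g h : heisenberg) :
  heis_a g = heis_a h -> heis_b g = heis_b h -> heis_c g = heis_c h -> g = h.
Proof.
move=> ha hb hc; apply: val_inj => /=.
have /unitriangularP[[g00 g11 g22] [g10 g20 g21]] := valP g.
have /unitriangularP[[h00 h11 h22] [h10 h20 h21]] := valP h.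
apply/matrixP; apply: ord3P; apply: ord3P;
  by rewrite ?(g00,g11,g22,g10,g20,g21,h00,h11,h22,h10,h20,h21).
Qed.

Lemma heis_aM (g h : heisenberg) : heis_a (g * h)%g = heis_a g + heis_a h.
Proof.
have /unitriangularP[[g00 g11 g22] [g10 g20 g21]] := valP g.
have /unitriangularP[[h00 h11 h22] [h10 h20 h21]] := valP h.
by rewrite /heis_a [heis_mx _]/= mulmx3E g00 h11 h21; ring.
Qed.

Lemma heis_bM (g h : heisenberg) : heis_b (g * h)%g = heis_b g + heis_b h.
Proof.
have /unitriangularP[[g00 g11 g22] [g10 g20 g21]] := valP g.
have /unitriangularP[[h00 h11 h22] [h10 h20 h21]] := valP h.
by rewrite /heis_b [heis_mx _]/= mulmx3E g11 g10 h22; ring.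
Qed.

Lemma heis_cM (g h : heisenberg) :
  heis_c (g * h)%g = heis_c g + heis_c h + heis_a g * heis_b h.
Proof.
have /unitriangularP[[g00 g11 g22] [g10 g20 g21]] := valP g.
have /unitriangularP[[h00 h11 h22] [h10 h20 h21]] := valP h.
by rewrite /heis_a /heis_b /heis_c [heis_mx _]/= mulmx3E g00 h22; ring.
Qed.

Lemma unitriangular_coord (a b c : int) : unitriangular
  (1%:M + a *: delta_mx 0 1 + b *: delta_mx 1 2 + c *: delta_mx 0 2).
Proof. by apply/unitriangularP; split; split; rewrite !mxE /=; ring. Qed.

Definition heis_of (a b c : int) : heisenberg :=
  Heisenberg (unitriangular_coord a b c).

Lemma heis_ofE a b c : (heis_a (heis_of a b c) = a) *
  (heis_b (heis_of a b c) = b) * (heis_c (heis_of a b c) = c).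
Proof. by rewrite /heis_a /heis_b /heis_c !mxE /=; do !split; ring. Qed.

Definition heisE := (heis_ofE, heis_aM, heis_bM, heis_cM).

Lemma heis1E : (heis_a 1%g = 0) * (heis_b 1%g = 0) * (heis_c 1%g = 0).
Proof. by rewrite /heis_a /heis_b /heis_c /= !mxE. Qed.

Lemma heis_gen_xE : gen_x = heis_of 1 0 0.
Proof.
by apply: heis_eq; rewrite heisE /heis_a /heis_b /heis_c !mxE.
Qed.

Lemma heis_gen_yE : gen_y = heis_of 0 1 0.
Proof.
by apply: heis_eq; rewrite heisE /heis_a /heis_b /heis_c !mxE.
Qed.

Lemma heis_gen_xV : (gen_x^-1)%g = heis_of (-1) 0 0.
Proof.
apply: (mulIg gen_x); rewrite mulVg heis_gen_xE.
by apply: heis_eq; rewrite !heisE heis1E; ring.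
Qed.

Lemma heis_gen_yV : (gen_y^-1)%g = heis_of 0 (-1) 0.
Proof.
apply: (mulIg gen_y); rewrite mulVg heis_gen_yE.
by apply: heis_eq; rewrite !heisE heis1E; ring.
Qed.

(* [h * z ^ d] for the central element z = x y x^-1 y^-1 *)
Definition zshift (h : heisenberg) (d : int) : heisenberg :=
  heis_of (heis_a h) (heis_b h) (heis_c h + d).

Definition xpred (h : heisenberg) : heisenberg := (h * gen_x^-1)%g.
Definition ypred (h : heisenberg) : heisenberg := (h * gen_y^-1)%g.

Lemma xpredE h : (heis_a (xpred h) = heis_a h - 1) *
  (heis_b (xpred h) = heis_b h) * (heis_c (xpred h) = heis_c h).
Proof. by rewrite /xpred heis_gen_xV !heisE; do !split; ring. Qed.

Lemma ypredE h : (heis_a (ypred h) = heis_a h) *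
  (heis_b (ypred h) = heis_b h - 1) * (heis_c (ypred h) = heis_c h - heis_a h).
Proof. by rewrite /ypred heis_gen_yV !heisE; do !split; ring. Qed.

Definition predE := (xpredE, ypredE, heis_ofE).

Lemma zshift0 h : zshift h 0 = h.
Proof. by apply: heis_eq; rewrite /zshift !heisE ?addr0. Qed.

Lemma zshiftD h d e : zshift (zshift h d) e = zshift h (d + e).
Proof. by apply: heis_eq; rewrite /zshift !heisE ?addrA. Qed.

Lemma zshiftMl g h d : zshift (g * h)%g d = (g * zshift h d)%g.
Proof. by apply: heis_eq; rewrite /zshift !heisE //; ring. Qed.

Lemma xpred_zshift h d : xpred (zshift h d) = zshift (xpred h) d.
Proof. by apply: heis_eq; rewrite /zshift !predE. Qed.

Lemma ypred_zshift h d : ypred (zshift h d) = zshift (ypred h) d.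
Proof. by apply: heis_eq; rewrite /zshift !predE //; ring. Qed.

(** The relation y^-1 x^-1 = x^-1 y^-1 z^-1: the two orders of a pair of steps end one central step
    apart, which is what the coupling exploits. *)
Lemma xpred_ypred h : xpred (ypred h) = zshift (ypred (xpred h)) (-1).
Proof. by apply: heis_eq; rewrite /zshift !predE //; ring. Qed.

Definition hdeg (h : heisenberg) : int := heis_a h + heis_b h.

Lemma hdeg_xpred h : hdeg (xpred h) = hdeg h - 1.
Proof. by rewrite /hdeg !predE; ring. Qed.

Lemma hdeg_ypred h : hdeg (ypred h) = hdeg h - 1.
Proof. by rewrite /hdeg !predE; ring. Qed.

Lemma hdeg_zshift h d : hdeg (zshift h d) = hdeg h.
Proof. by rewrite /hdeg /zshift !heisE. Qed.

(** * Decay of averages along the centre and summability of the Green series *)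

Lemma lim_tail (R : realType) (u : R^nat) (K : R) :
  (forall N k, `|u (N + k)%N - u N| <= K / N.+1%:R) ->
  forall N, `|limn u - u N| <= K / N.+1%:R.
Proof.
move=> uK.
have K0 : 0 <= K by have := uK 0%N 0%N; rewrite subrr normr0 divr1.
have cvgu : cvgn u.
  apply/cauchy_cvgP/cauchy_exP => e e0.
  (* Dividing by [K + 1] instead of [K] covers the case [K = 0]. *)
  have : \forall k \near \oo, k.+1%:R^-1 < e / (K + 1).
    have e0' : 0 < e / (K + 1) by rewrite divr_gt0// ltr_wpDl.
    exact: (near_infty_natSinv_lt (PosNum e0')).
  case=> N _ /(_ N (leqnn _)); rewrite /= ltr_pdivlMr ?ltr_wpDl// => Ne.
  exists (u N); exists N => //= n /subnKC <-.
  rewrite -ball_normE /ball_/= distrC (le_lt_trans (uK _ _))//.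
  rewrite (le_lt_trans _ Ne)// mulrC ler_wpM2l// lerDl//.
move=> N; have cvgN : (fun n => `|u n - u N|) @ \oo --> `|limn u - u N|.
  by apply: cvg_norm; apply: cvgB => //; exact: cvg_cst.
rewrite -(cvg_lim (@Rhausdorff R) cvgN); apply: limr_le.
  by apply/cvg_ex; exists `|limn u - u N|.
by exists N => //= n /subnKC <-.
Qed.

Section Operators.
Variable R : realType.
Implicit Types (v w : heisenberg -> R) (h : heisenberg) (M : R).

Definition avg v h : R := (v (xpred h) + v (ypred h)) / 2.
(** This is rho^(1 - z^-1), which takes the part of 1 - z; as z is central, it commutes with
    [avg]. *)
Definition zdiff v h : R := v h - v (zshift h (-1)).

Lemma avg_zdiff v : avg (zdiff v) = zdiff (avg v).
Proof.
by apply/funext => h; rewrite /avg /zdiff !xpred_zshift !ypred_zshift; field.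
Qed.

Lemma iter_avg_zdiff n v : iter n avg (zdiff v) = zdiff (iter n avg v).
Proof. by elim: n => //= n ->; rewrite avg_zdiff. Qed.

Lemma avg_iter_zdiff n v : avg (iter n zdiff v) = iter n zdiff (avg v).
Proof. by elim: n => //= n <-; rewrite avg_zdiff. Qed.

Definition bounded_by M v := forall h, `|v h| <= M.

Lemma avg_bounded M v : bounded_by M v -> bounded_by M (avg v).
Proof.
move=> vM h; rewrite /avg.
have := vM (xpred h); have := vM (ypred h); rewrite !ler_norml; lra.
Qed.

Lemma iter_avg_bounded n M v : bounded_by M v -> bounded_by M (iter n avg v).
Proof. by move=> vM; elim: n => //= n; exact: avg_bounded. Qed.

Lemma avg2E v h : avg (avg v) h =
  ((v (xpred (xpred h)) + v (ypred (ypred h))) / 2 +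
   (v (ypred (xpred h)) + v (zshift (ypred (xpred h)) (-1))) / 2) / 2.
Proof. by rewrite /avg xpred_ypred; field. Qed.

(* Mirror coupling of the walks started at [h] and at [zshift h (- d)]: writing
   Z for the shift by z^-1, avg^2 = (A + B (1 + Z) / 2) / 2 where A and B are
   averages commuting with Z, and
   (1 + Z) (1 - Z^d) = (1 - Z^(d+1)) + Z (1 - Z^(d-1)). Hence the distance [d]
   performs a lazy simple random walk absorbed at 0; the right-hand side
   compares it with the exit problem from [0, L], using the martingales
   [d] and [d (L - d) + k / 2]. *)
Lemma coupling M v (L k d : nat) h : bounded_by M v -> (d <= L)%N -> (0 < L)%N ->
  k%:R * `|iter k (avg \o avg) v h - iter k (avg \o avg) v (zshift h (- d%:Z))| <=
  (2 * k%:R * d%:R / L%:R + 4 * d%:R * (L%:R - d%:R)) * M.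
Proof.
move=> vM + L0; elim: k d h => [|k IH] d h dL.
  rewrite mul0r !mulr0 !mul0r add0r mulr_ge0 //.
    by rewrite mulr_ge0// subr_ge0 ler_nat.
  exact: le_trans (vM 1%g).
have kM j g : `|iter j (avg \o avg) v g| <= M.
  by elim: j g => //= j IHj g; do 2!apply: avg_bounded.
have triv j g g' : `|iter j (avg \o avg) v g - iter j (avg \o avg) v g'| <= 2 * M.
  rewrite (le_trans (ler_normB _ _))//; have := kM j g; have := kM j g'; lra.
have L0' : 0 < L%:R :> R by rewrite ltr0n.
have M0 : 0 <= M by exact: le_trans (vM 1%g).
case: d dL => [|d] dL.
  by rewrite oppr0 zshift0 subrr normr0 mulr0 !mulr0 !mul0r add0r mul0r.
move: dL; rewrite leq_eqVlt => /predU1P[dL|dL].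
  rewrite dL subrr mulr0 addr0 mulfK ?gt_eqF// [2 * _]mulrC -mulrA.
  by rewrite ler_wpM2l.
set w := iter k (avg \o avg) v in IH kM triv *.
set t := iter k.+1 _ v h - _.
have tle : `|t| <= 2 * M by exact: triv.
pose dif (e : nat) g := w g - w (zshift g (- e%:Z)).
have split_t : t = (dif d.+1 (xpred (xpred h)) + dif d.+1 (ypred (ypred h))
   + dif d.+2 (ypred (xpred h)) + dif d (zshift (ypred (xpred h)) (-1))) / 4.
  rewrite /t /dif !iterS -/w /= !avg2E !xpred_zshift !ypred_zshift !zshiftD.
  have -> : - d.+1%:Z + -1 = - d.+2%:Z by lia.
  have -> : -1 - d%:Z = - d.+1%:Z by lia.
  by field.
have dL' : (d <= L)%N by lia.
have IHdif e g : (e <= L)%N -> k%:R * `|dif e g| <= _ := @IH e g.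
have h1 := IHdif _ (xpred (xpred h)) (ltnW dL).
have h2 := IHdif _ (ypred (ypred h)) (ltnW dL).
have h3 := IHdif _ (ypred (xpred h)) dL.
have h4 := IHdif _ (zshift (ypred (xpred h)) (-1)) dL'.
move: (dif d.+1 (xpred _)) h1 split_t => t1 h1.
move: (dif d.+1 (ypred _)) h2 => t2 h2.
move: (dif _ _) h3 => t3 h3.
move: (dif _ _) h4 => t4 h4 split_t.
have tsum : `|t| <= (`|t1| + `|t2| + `|t3| + `|t4|) / 4.
  rewrite split_t normrM (@ger0_norm _ (4^-1)) ?invr_ge0//.
  rewrite ler_wpM2r ?invr_ge0//.
  by do 3!rewrite (le_trans (ler_normD _ _))// lerD//.
have ktsum : k%:R * `|t| <= (k%:R * `|t1| + k%:R * `|t2| + k%:R * `|t3| + k%:R * `|t4|) / 4.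
  by rewrite -!mulrDr -mulrA ler_wpM2l.
rewrite -[k.+1%:R]natr1 mulrDl mul1r.
set l := L%:R^-1 in h1 h2 h3 h4 *.
rewrite -[d.+2%:R]natr1 -[d.+1%:R]natr1 in h1 h2 h3 h4 *.
have l0 : 0 <= l by rewrite invr_ge0 ltW.
have dlM : 0 <= d%:R * l * M by rewrite !mulr_ge0.
have lM : 0 <= l * M by rewrite !mulr_ge0.
(* Passing from k to k + 1 adds one [|t|], at most 2 M. Averaging over the four new distances lowers
   4 d (L - d) by exactly 2, which pays for it. *)
move: ktsum h1 h2 h3 h4 tle dlM lM.
move: (k%:R * `|t1|) (k%:R * `|t2|) (k%:R * `|t3|) (k%:R * `|t4|) => T1 T2 T3 T4.
move: (k%:R * `|t|) `|t| k%:R d%:R L%:R => kt nt K e l'; lra.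
Qed.

Lemma iter_avg2 k v : iter k (avg \o avg) v = iter (2 * k) avg v.
Proof. by elim: k => // k IH; rewrite mulnS iterS IH. Qed.

Lemma bounded_by_ge0 M v : bounded_by M v -> 0 <= M.
Proof. by move=> /(_ 1%g); exact: le_trans. Qed.

(** Coupling at distance 1 with L^2 double steps: both terms of the bound are O(L), and division by
    L^2 leaves O(1 / L). *)
Lemma zdiff_avg_bounded M v (L : nat) : (0 < L)%N -> bounded_by M v ->
  bounded_by (6 / L%:R * M) (iter (2 * L ^ 2) avg (zdiff v)).
Proof.
move=> L0 vM h; have := coupling (L ^ 2) h vM L0 L0.
rewrite !iter_avg2 iter_avg_zdiff /zdiff natrX => H.
have L0' : 0 < L%:R :> R by rewrite ltr0n.
have M0 := bounded_by_ge0 vM.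
rewrite -(ler_pM2l (exprn_gt0 2 L0')) (le_trans H)//.
rewrite (_ : L%:R ^+ 2 * (6 / L%:R * M) = 6 * L%:R * M); last first.
  by field; rewrite gt_eqF.
rewrite (_ : 2 * L%:R ^+ 2 * 1 / L%:R = 2 * L%:R); last by field; rewrite gt_eqF.
by rewrite ler_wpM2r//; lra.
Qed.

Definition zdiff4 v := iter 4 zdiff v.

(** As [zdiff] commutes with [avg], the 8 L^2 steps split into four blocks of 2 L^2, each absorbing
    one difference and contributing a factor 6 / L. *)
Lemma zdiff4_avg_bounded_sq M v (L : nat) : (0 < L)%N -> bounded_by M v ->
  bounded_by ((6 / L%:R) ^+ 4 * M) (iter (8 * L ^ 2) avg (zdiff4 v)).
Proof.
move=> L0 vM; pose E := iter (2 * L ^ 2) avg \o zdiff.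
have -> : iter (8 * L ^ 2) avg (zdiff4 v) = iter 4 E v.
  rewrite /E /zdiff4 /= !iter_avg_zdiff -!iterD.
  by congr (zdiff (zdiff (zdiff (zdiff (iter _ _ _))))); lia.
suff H k : bounded_by ((6 / L%:R) ^+ k * M) (iter k E v) by [].
elim: k => [|k IH]; first by rewrite expr0 mul1r.
by rewrite exprS -(mulrA (6 / L%:R)); exact: zdiff_avg_bounded.
Qed.

Lemma zdiff_bounded M v : bounded_by M v -> bounded_by (2 * M) (zdiff v).
Proof.
move=> vM h; rewrite (le_trans (ler_normB _ _))//.
by have := vM h; have := vM (zshift h (-1)); lra.
Qed.

Lemma zdiff4_bounded M v : bounded_by M v -> bounded_by (16 * M) (zdiff4 v).
Proof.
move=> /zdiff_bounded/zdiff_bounded/zdiff_bounded/zdiff_bounded H h.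
by apply: le_trans (H h) _; lra.
Qed.

(** The rate n^-2 is written with (n + 1) (n + 2) so that its sums telescope. *)
Lemma zdiff4_avg_bounded : exists2 C : R, 0 <= C & forall M v n, bounded_by M v ->
  bounded_by (C / (n.+1 * n.+2)%:R * M) (iter n avg (zdiff4 v)).
Proof.
exists (6 ^+ 4 * 33 * 32) => [|M v n vM]; first by rewrite !mulr_ge0.
have M0 := bounded_by_ge0 vM.
have n0 : 0 < (n.+1 * n.+2)%:R :> R by rewrite ltr0n muln_gt0.
suff [B Bn vB] : exists2 B : R, B * (n.+1 * n.+2)%:R <= 6 ^+ 4 * 33 * 32
    & bounded_by (B * M) (iter n avg (zdiff4 v)).
  move=> h; apply: le_trans (vB h) _; rewrite ler_wpM2r//.
  by rewrite ler_pdivlMr.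
have [n8|n8] := ltnP n 8.
  exists 16; last exact/iter_avg_bounded/zdiff4_bounded.
  have : (n.+1 * n.+2 <= 72)%N by nia.
  rewrite -(ler_nat R); lra.
(* For the largest such L, n < 8 (L + 1)^2 <= 32 L^2; this gives the factors 32 and 33 in the
   constant. *)
have [L [L0 Ln nL]] : exists L, [/\ (0 < L)%N, (8 * L ^ 2 <= n)%N & (n < 8 * L.+1 ^ 2)%N].
  have ex1 : exists L, (8 * L ^ 2 <= n)%N by exists 1%N.
  have bd L : (8 * L ^ 2 <= n)%N -> (L <= n)%N by move=> ?; nia.
  case: (ex_maxnP ex1 bd) => L Ln Lmax; exists L; split => //.
    exact: Lmax 1%N n8.
  by rewrite ltnNge; apply/negP => /Lmax; rewrite ltnn.
exists ((6 / L%:R) ^+ 4); last first.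
  rewrite -(subnK Ln) iterD.
  exact/iter_avg_bounded/zdiff4_avg_bounded_sq.
have L0' : 0 < L%:R :> R by rewrite ltr0n.
have key : (n.+1 * n.+2)%:R <= 33 * 32 * L%:R ^+ 4 :> R.
  rewrite -natrX -!natrM ler_nat.
  have : (n.+1 <= 32 * L ^ 2)%N by nia.
  have : (n.+2 <= 33 * L ^ 2)%N by nia.
  rewrite (_ : L ^ 4 = L ^ 2 * L ^ 2)%N; last by rewrite -expnD.
  move: (L ^ 2)%N => q; nia.
rewrite expr_div_n mulrAC ler_pdivrMr ?exprn_gt0//.
rewrite -[_ * 33 * 32]mulrA -[leRHS]mulrA.
by apply: ler_wpM2l key; rewrite exprn_ge0.
Qed.

Definition psum (N : nat) v h : R := \sum_(n < N) iter n avg (zdiff4 v) h / 2.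

Lemma psumS N v h : psum N.+1 v h = psum N v h + iter N avg (zdiff4 v) h / 2.
Proof. by rewrite /psum big_ord_recr. Qed.

(* Formally v * (1 - z)^4 f^-1: the factor (1 - z)^4 makes the Green function
   f^-1 = sum_n avg^n / 2 summable. *)
Definition green v h : R := limn (fun N => psum N v h).

(** Telescoping 1 / (n + 1) - 1 / (n + 2) bounds the tail uniformly in [h] and in all [v] with the
    same bound; continuity and surjectivity of the covering map both rest on this uniformity. *)
Lemma psum_tail : exists2 C : R, 0 <= C &
  (forall M v n h, bounded_by M v -> `|iter n avg (zdiff4 v) h| <= C * M / n.+1%:R) /\
  forall M v N h, bounded_by M v ->
  `|green v h - psum N v h| <= C * M / N.+1%:R.
Proof.
have [C C0 CB] := zdiff4_avg_bounded; exists C => //.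
have CM0 M v : bounded_by M v -> 0 <= C * M.
  by move=> /bounded_by_ge0 M0; rewrite mulr_ge0.
have inv0 (N : nat) : 0 < N.+1%:R :> R by rewrite ltr0n.
have split1 (n : nat) : ((n.+1 * n.+2)%:R)^-1 = n.+1%:R^-1 - n.+2%:R^-1 :> R.
  rewrite natrM -[n.+2%:R]natr1; move: n.+1%:R (inv0 n) => x x0.
  by field; rewrite !gt_eqF// ltr_wpDl// ltW.
split=> [M v n h vM|M v N h vM].
  apply: le_trans (CB _ _ _ vM h) _; rewrite mulrAC ler_wpM2l ?(CM0 _ v)//.
  by rewrite lef_pV2 ?posrE ?ltr0n ?muln_gt0// ler_nat leq_pmulr.
have cauchy N1 k : `|psum (N1 + k) v h - psum N1 v h| <=
    C * M * (N1.+1%:R^-1 - (N1 + k).+1%:R^-1).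
  elim: k => [|k IH]; first by rewrite addn0 !subrr normr0 mulr0.
  rewrite addnS psumS addrAC (le_trans (ler_normD _ _))//.
  have := CB _ _ (N1 + k)%N vM h; rewrite split1 mulrAC.
  rewrite normrM (@ger0_norm _ 2^-1) ?invr_ge0//.
  move: IH (normr_ge0 (iter (N1 + k) avg (zdiff4 v) h)).
  move: `|psum _ _ _ - _| `|iter _ _ _ _| => s t.
  move: (C * M) (N1.+1%:R^-1 : R) ((N1 + k).+1%:R^-1 : R) ((N1 + k).+2%:R^-1 : R) => K a b c; lra.
have cauchyN N1 k : `|psum (N1 + k) v h - psum N1 v h| <= C * M / N1.+1%:R.
  apply: le_trans (cauchy _ _) _; rewrite ler_wpM2l ?(CM0 _ v)//.
  by rewrite lerBlDr lerDl invr_ge0.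
exact: lim_tail cauchyN N.
Qed.
End Operators.

(** * Identities, locality and supports for the Green series *)

Section Green.
Variable R : realType.
Implicit Types (v w u : heisenberg -> R) (h : heisenberg) (M : R) (m : int).

Lemma eq0_archi (x K : R) : (forall N : nat, `|x| <= K / N.+1%:R) -> x = 0.
Proof.
move=> H; apply/eqP; rewrite -normr_eq0 eq_le normr_ge0 andbT.
have K0 : 0 <= K by have := H 0%N; rewrite divr1; exact: le_trans.
apply/ler_addgt0Pr => e e0; rewrite add0r.
have e0' : 0 < e / (K + 1) by rewrite divr_gt0// ltr_wpDl.
have [N _ /(_ N (leqnn _))/=] := near_infty_natSinv_lt (PosNum e0').
rewrite /= ltr_pdivlMr ?ltr_wpDl// => Ne.
apply: le_trans (H N) _; apply: le_trans (ltW Ne).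
by rewrite mulrC ler_wpM2l// lerDl.
Qed.

(** Real-valued counterpart of rho^f, for lifts of circle-valued configurations. *)
Definition rho_op v h : R := 2 * v h - v (xpred h) - v (ypred h).

Lemma rho_opE v h : rho_op v h = 2 * (v h - avg v h).
Proof. by rewrite /rho_op /avg; field. Qed.

Lemma rho_op_zdiff v h : rho_op (zdiff v) h = rho_op v h - rho_op v (zshift h (-1)).
Proof. by rewrite /rho_op /zdiff !xpred_zshift !ypred_zshift; ring. Qed.

Lemma avgB v w : avg (fun h => v h - w h) = (fun h => avg v h - avg w h).
Proof. by apply/funext => h; rewrite /avg; field. Qed.

Lemma zdiffB v w : zdiff (fun h => v h - w h) = (fun h => zdiff v h - zdiff w h).
Proof. by apply/funext => h; rewrite /zdiff; ring. Qed.

Lemma iter_avgB n v w :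
  iter n (@avg R) (fun h => v h - w h) =
  (fun h => iter n (@avg R) v h - iter n (@avg R) w h).
Proof. by elim: n => //= n ->; rewrite avgB. Qed.

Lemma iter_zdiffB n v w :
  iter n (@zdiff R) (fun h => v h - w h) =
  (fun h => iter n (@zdiff R) v h - iter n (@zdiff R) w h).
Proof. by elim: n => //= n ->; rewrite zdiffB. Qed.

Lemma psumB N v w h : psum N (fun h => v h - w h) h = psum N v h - psum N w h.
Proof.
elim: N => [|N IH]; first by rewrite /psum !big_ord0 subrr.
by rewrite !psumS IH /zdiff4 iter_zdiffB iter_avgB; ring.
Qed.

(** Geometric series: the sum of avg^n (1 - avg) over n < N telescopes to 1 - avg^N. *)
Lemma psum_rho_op N v h : psum N (rho_op v) h = zdiff4 v h - iter N (@avg R) (zdiff4 v) h.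
Proof.
have -> : rho_op v = (fun h => 2 * (v h - avg v h)) by apply/funext => ?; rewrite rho_opE.
have scale k (w : heisenberg -> R) :
    iter k (@zdiff R) (fun h => 2 * w h) = fun h => 2 * iter k (@zdiff R) w h.
  by elim: k => //= k ->; apply/funext => g; rewrite /zdiff; ring.
have scale' k (w : heisenberg -> R) :
    iter k (@avg R) (fun h => 2 * w h) = fun h => 2 * iter k (@avg R) w h.
  by elim: k => //= k ->; apply/funext => g; rewrite /avg; ring.
elim: N => [|N IH]; first by rewrite /psum big_ord0 subrr.
rewrite psumS IH /zdiff4 scale scale' iter_zdiffB iter_avgB -avg_iter_zdiff.
by rewrite -iterSr; field.
Qed.

Lemma rho_op_psum N v h :
  rho_op (psum N v) h = zdiff4 v h - iter N (@avg R) (zdiff4 v) h.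
Proof.
elim: N h => [|N IH] h; first by rewrite /rho_op /psum !big_ord0 subrr; ring.
have := IH h; rewrite /rho_op !psumS [iter N.+1]lock /= -lock iterS /avg; lra.
Qed.

Lemma rho_op_green M v h : bounded_by M v -> rho_op (green v) h = zdiff4 v h.
Proof.
move=> vM; have [C C0 [CB tail]] := psum_tail R.
(* Replacing [green] by [psum] costs 2 + 1 + 1 times C M / (N + 1), and the remainder avg^N costs it
   once more. *)
apply/eqP; rewrite -subr_eq0; apply/eqP; apply: (@eq0_archi _ (5 * (C * M))) => N.
have := rho_op_psum N v h; have := CB _ _ N h vM.
have := tail _ _ N h vM; have := tail _ _ N (xpred h) vM; have := tail _ _ N (ypred h) vM.
rewrite /rho_op -[5 * _ / _]mulrA;
move: (C * M / _) (iter N _ _ _) (psum N v) => K t p.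
by rewrite !ler_norml; lra.
Qed.

(** [avg] and [zdiff] move the argument by right multiplication, hence commute with left
    translation; this becomes the equivariance of the covering map. *)
Lemma green_translate v g h : green (fun k => v (g * k)%g) h = green v (g * h)%g.
Proof.
have transl n : iter n (@zdiff R) (fun k => v (g * k)%g) =
    fun k => iter n (@zdiff R) v (g * k)%g.
  by elim: n => //= n ->; apply/funext => k; rewrite /zdiff zshiftMl.
have transl' n (w : heisenberg -> R) : iter n (@avg R) (fun k => w (g * k)%g) =
    fun k => iter n (@avg R) w (g * k)%g.
  by elim: n => //= n ->; apply/funext => k; rewrite /avg /xpred /ypred !mulgA.
rewrite /green; congr (limn _); apply/funext => N; apply: eq_bigr => i _.
by rewrite /zdiff4 transl transl'.
Qed.

(** The finite window [K] depends on [h] only, not on the configuration. *)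
Definition local (T : (heisenberg -> R) -> heisenberg -> R) := forall h,
  exists K : {fset heisenberg}, forall v w, {in K, v =1 w} -> T v h = T w h.

Lemma local_iter n (T : (heisenberg -> R) -> heisenberg -> R) (s t : heisenberg -> heisenberg)
    (F : R -> R -> R) :
  local T -> local (fun v => iter n (fun u h => F (u (s h)) (u (t h))) (T v)).
Proof.
move=> lT; elim: n => //= n IH h.
have [K1 HK1] := IH (s h); have [K2 HK2] := IH (t h).
exists (K1 `|` K2)%fset => v w vw.
rewrite (HK1 v w) ?(HK2 v w)// => k kK; apply: vw; rewrite in_fsetU kK ?orbT//.
Qed.

Lemma local_psum N : local (@psum R N).
Proof.
move=> h; elim: N => [|N [K HK]].
  by exists fset0 => v w _; rewrite /psum !big_ord0.
have local_id : local id by move=> g; exists [fset g]%fset => v w; apply; rewrite in_fset1.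
have [K' HK'] := @local_iter N _ xpred ypred (fun a b => (a + b) / 2)
  (@local_iter 4 _ id (zshift ^~ (-1)) (fun a b => a - b) local_id) h.
exists (K `|` K')%fset => v w vw; rewrite !psumS.
by congr (_ + _ / 2); [apply: HK | apply: HK'] => k kK;
  apply: vw; rewrite in_fsetU kK ?orbT.
Qed.

Section Support.
Variables (Q : int -> Prop).

Definition vanish v := forall h, Q (hdeg h) -> v h = 0.
Lemma zdiff4_vanish v : vanish v -> vanish (zdiff4 v).
Proof.
have zd w : vanish w -> vanish (zdiff w).
  by move=> w0 h Qh; rewrite /zdiff !w0 ?hdeg_zshift ?subrr.
by move=> v0; do 4!apply/zd.
Qed.

(** Each step lowers the degree by exactly one, so avg^n at [h] sees only the level [hdeg h - n]. *)
Lemma iter_avg_vanish n v h : vanish v -> Q (hdeg h - n%:Z) -> iter n (@avg R) v h = 0.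
Proof.
move=> v0; elim: n h => [|n IH] h; first by rewrite subr0; exact: v0.
move=> Qh; rewrite iterS /avg !IH ?addr0 ?mul0r//.
  by rewrite hdeg_ypred; move: Qh; congr Q; lia.
by rewrite hdeg_xpred; move: Qh; congr Q; lia.
Qed.
End Support.

End Green.

(** * Recursion and induction on the degree *)

Section LevelRec.
Variables (A : Type) (m : int) (base : heisenberg -> A)
  (step : heisenberg -> A -> A -> A).

Fixpoint level_fuel (k : nat) (h : heisenberg) : A :=
  if k is k'.+1 then step h (level_fuel k' (xpred h)) (level_fuel k' (ypred h))
  else base h.

(** The height above level [m] serves as fuel, since both predecessors lower it by exactly one. *)
Definition level_rec (h : heisenberg) : A :=
  if hdeg h - m is Posz k then level_fuel k h else base h.

Lemma level_rec_base h : (hdeg h <= m)%R -> level_rec h = base h.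
Proof.
rewrite -subr_le0 /level_rec; case: (hdeg h - m) => [[|k]|k]//.
Qed.

Lemma level_rec_step h : (m < hdeg h)%R ->
  level_rec h = step h (level_rec (xpred h)) (level_rec (ypred h)).
Proof.
rewrite -subr_gt0 /level_rec hdeg_xpred hdeg_ypred.
case E : (hdeg h - m) => [[|k]|k]// _.
by rewrite addrAC E (_ : Posz k.+1 - 1 = Posz k)//; lia.
Qed.

Lemma level_ind (Q : heisenberg -> Prop) :
  (forall h, (hdeg h <= m)%R -> Q h) ->
  (forall h, (m < hdeg h)%R -> Q (xpred h) -> Q (ypred h) -> Q h) ->
  forall h, Q h.
Proof.
move=> Q0 QS h.
suff H (k : nat) g : (hdeg g - m <= k%:Z)%R -> Q g.
  by apply: (H `|hdeg h - m|%N); lia.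
elim: k g => [|k IH] g gk; first by apply: Q0; lia.
have [gm|gm] := leP (hdeg g) m; first exact: Q0.
by apply: QS => //; apply: IH; rewrite ?hdeg_xpred ?hdeg_ypred; lia.
Qed.
End LevelRec.

(** * Antidifferences, digit lifts and approximate preimages *)

Section Lift.
Variable R : realType.
Implicit Types (v w u : heisenberg -> R) (h : heisenberg) (M : R) (m : int).

Lemma int_primitive (g : int -> R) : exists s : int -> R, forall n, s n - s (n - 1) = g n.
Proof.
exists (fun n => match n with
  | Posz n => \sum_(i < n) g (Posz i.+1)
  | Negz n => - \sum_(i < n.+1) g (- Posz i) end).
case=> [[|n]|n].
- by rewrite sub0r /= big_ord0 big_ord_recl big_ord0 addr0 oppr0 sub0r opprK.
- have -> : Posz n.+1 - 1 = Posz n by lia.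
  by rewrite big_ord_recr /= addrAC subrr add0r.
have -> : Negz n - 1 = Negz n.+1 by lia.
by rewrite [in X in _ - X]big_ord_recr/= opprK addKr NegzE.
Qed.

(** A discrete primitive in c is chosen separately on each coset of the centre. *)
Lemma zdiff_surj u : exists v, zdiff v = u.
Proof.
have /choice[s sP] (ab : int * int) := int_primitive (fun c => u (heis_of ab.1 ab.2 c)).
exists (fun h => s (heis_a h, heis_b h) (heis_c h)); apply/funext => h.
rewrite /zdiff /zshift !heisE sP /=; congr u.
by apply: heis_eq; rewrite !heisE.
Qed.

(** Any antidifference [v0] of [u] may be corrected by a z-invariant [t]. Solving for [t] level by
    level makes [rho_op v] vanish at c = 0 above level m; along each central coset its increments
    are values of [rho_op u], so it stays integral. *)
Lemma zdiff_surj_rho_op m u : (forall h, m < hdeg h -> rho_op u h \is a Num.int) ->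
  exists2 v, zdiff v = u & forall h, m < hdeg h -> rho_op v h \is a Num.int.
Proof.
move=> uint; have [v0 v0u] := zdiff_surj u.
pose b0 h := heis_of (heis_a h) (heis_b h) 0.
pose t := level_rec m (fun=> 0 : R) (fun h p q => (p + q - rho_op v0 (b0 h)) / 2).
have tS h : m < hdeg h -> t h = (t (xpred h) + t (ypred h) - rho_op v0 (b0 h)) / 2.
  exact: level_rec_step.
have tz h : forall d, t (zshift h d) = t h.
  elim/(@level_ind m) : h => h hm => [|IHx IHy] d.
    by rewrite /t !level_rec_base ?hdeg_zshift.
  have hdm : m < hdeg (zshift h d) by rewrite hdeg_zshift.
  rewrite (tS h hm) (tS _ hdm) xpred_zshift ypred_zshift IHx IHy.
  by rewrite (_ : b0 (zshift h d) = b0 h)// /b0 /zshift !heisE.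
exists (fun h => v0 h + t h).
  by rewrite -v0u; apply/funext => h; rewrite /zdiff tz; ring.
set v := (fun h => _); move=> h hm.
have zv : zdiff v = u by rewrite -v0u; apply/funext => g; rewrite /v /zdiff tz; ring.
have base0 : rho_op v (b0 h) = 0.
  have th : rho_op v (b0 h) = rho_op v0 (b0 h) + rho_op t (b0 h).
    by rewrite /rho_op /v; ring.
  rewrite th [rho_op t _]/rho_op (tS (b0 h)) ?/hdeg ?heisE//.
  rewrite (_ : b0 (b0 h) = b0 h) /rho_op; first by field.
  by rewrite /b0 !heisE.
have deg0 d : m < hdeg (zshift (b0 h) d) by rewrite hdeg_zshift /hdeg !heisE.
have -> : h = zshift (b0 h) (heis_c h).
  by apply: heis_eq; rewrite /zshift !heisE ?add0r.
have step d : rho_op v (zshift (b0 h) d) - rho_op v (zshift (b0 h) (d - 1)) \is a Num.int.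
  by have := uint _ (deg0 d); rewrite -zv rho_op_zdiff zshiftD.
elim/int_rect: (heis_c h) => [|n IH|n IH].
- by rewrite zshift0 base0 rpred0.
- by have := rpredD (step n.+1) IH; rewrite (_ : Posz n.+1 - 1 = Posz n) ?subrK//; lia.
- have := rpredB IH (step (- Posz n)).
  rewrite (_ : - Posz n - 1 = - Posz n.+1); last by lia.
  by rewrite opprB addrC subrK.
Qed.

Lemma zdiff4_surj_rho_op m u : (forall h, m < hdeg h -> rho_op u h \is a Num.int) ->
  exists2 v, zdiff4 v = u & forall h, m < hdeg h -> rho_op v h \is a Num.int.
Proof.
move=> /zdiff_surj_rho_op[u1 <- /zdiff_surj_rho_op[u2 <-]].
move=> /zdiff_surj_rho_op[u3 <- /zdiff_surj_rho_op[u4 <- h4]].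
by exists u4.
Qed.

Lemma carry_digit (x : R) : x \is a Num.int ->
  exists n : int, x + 2 * n%:~R = 0 \/ x + 2 * n%:~R = 1.
Proof.
move=> /intrP[k ->]; exists (- (k %/ 2)%Z).
have := divz_eq k 2; have := modz_ge0 k (isT : 2 != 0 :> int).
have := ltz_pmod k (isT : 0 < 2 :> int).
move: (k %/ 2)%Z (k %% 2)%Z => q [[|[|//]]|//] _ _ ->.
  by left; rewrite addr0 intrM mulrNz; ring.
by right; rewrite intrD intrM mulrNz; ring.
Qed.

(** Levels are treated in increasing order. Once the predecessors are fixed, adding an integer n to
    [L h] changes [rho_op L h] by 2 n, so the integer value there can be reduced to its parity. *)
Lemma digit_lift m u : (forall h, m < hdeg h -> rho_op u h \is a Num.int) ->
  exists L : heisenberg -> R,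
  [/\ forall h, hdeg h < m -> L h = 0,
      forall h, m <= hdeg h -> L h - u h \is a Num.int,
      forall h, hdeg h = m -> 0 <= L h < 1 &
      forall h, m < hdeg h -> rho_op L h = 0 \/ rho_op L h = 1].
Proof.
move=> uint.
have /choice[dig digP] (x : R) : exists n : int, x \is a Num.int ->
    (x + 2 * n%:~R = 0 \/ x + 2 * n%:~R = 1).
  have [xi|xi] := pselect (x \is a Num.int); last by exists 0.
  by have [n nP] := carry_digit xi; exists n.
pose L := level_rec m
  (fun h => if hdeg h == m then u h - (Num.floor (u h))%:~R else 0)
  (fun h p q => u h + (dig (2 * u h - p - q))%:~R).
have LS h : m < hdeg h ->
    L h = u h + (dig (2 * u h - L (xpred h) - L (ypred h)))%:~R.
  exact: level_rec_step.
have LB h : hdeg h <= m ->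
    L h = if hdeg h == m then u h - (Num.floor (u h))%:~R else 0.
  exact: level_rec_base.
have Lu h : m <= hdeg h -> L h - u h \is a Num.int.
  rewrite le_eqVlt => /predU1P[hm|hm].
    by rewrite LB -?hm// eqxx addrAC subrr add0r rpredN intr_int.
  by rewrite LS// addrAC subrr add0r intr_int.
exists L; split => //.
- by move=> h hm; rewrite LB ?(ltW hm)// lt_eqF.
- move=> h hm; rewrite LB ?hm// eqxx.
  by have := floor_itv (u h); rewrite intrD; lra.
move=> h hm; set x := 2 * u h - L (xpred h) - L (ypred h).
have := digP x; have -> : x + 2 * (dig x)%:~R = rho_op L h.
  by rewrite /rho_op [L h]LS// /x; ring.
apply; have -> : x = rho_op u h - (L (xpred h) - u (xpred h)) - (L (ypred h) - u (ypred h)).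
  by rewrite /x /rho_op; ring.
have px : m <= hdeg (xpred h) by rewrite hdeg_xpred; lia.
have py : m <= hdeg (ypred h) by rewrite hdeg_ypred; lia.
by apply: rpredB; [apply: rpredB; [exact: uint|exact: Lu]|exact: Lu].
Qed.

(** Let [L] be the digit lift of a fourth antidifference [u'] of [u], and [v] the part of [rho_op L]
    above level m. At degree m + n, [zdiff4 L] equals [u] up to an integer, and equals [green v] up
    to the tail of the series and half of avg^n applied to the differences of [e], the part on level
    m. Both errors are O(1 / n). *)
Lemma green_approx : exists2 C : R, 0 <= C &
  forall u, (forall h, rho_op u h \is a Num.int) -> forall m,
  exists2 v, (forall h, v h = 0 \/ v h = 1) & forall h (n : nat), hdeg h = m + n%:Z ->
    exists2 k : R, k \is a Num.int & `|green v h - u h - k| <= C / n.+1%:R.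
Proof.
have [C C0 [CB tail]] := psum_tail R; exists (2 * C); first by rewrite mulr_ge0.
move=> u uint m; have [//|u' u'u u'int] := @zdiff4_surj_rho_op m u.
have [L [L0 Lu' Lm Ldig]] := digit_lift u'int.
pose v h := if m < hdeg h then rho_op L h else 0.
pose e h := rho_op L h - v h.
have v01 h : v h = 0 \/ v h = 1.
  by rewrite /v; case: ifP => [/Ldig//|_]; left.
have vB : bounded_by 1 v by move=> h; case: (v01 h) => ->; rewrite ?normr0 ?normr1.
have Lx h : hdeg h <= m -> rho_op L h = 2 * L h.
  move=> hm; rewrite /rho_op.
  have -> : L (xpred h) = 0 by apply: L0; rewrite hdeg_xpred; lia.
  have -> : L (ypred h) = 0 by apply: L0; rewrite hdeg_ypred; lia.
  by rewrite !subr0.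
have e0 h : hdeg h != m -> e h = 0.
  rewrite neq_lt /e /v => /orP[hm|hm].
    by rewrite ltNge (ltW hm)/= Lx ?ltW// L0// mulr0 subr0.
  by rewrite hm subrr.
have eB : bounded_by 2 e.
  move=> h; have [hm|hm] := eqVneq (hdeg h) m; last by rewrite e0 ?normr0.
  rewrite /e /v hm ltxx subr0 Lx ?hm//; have := Lm h hm.
  by rewrite ler_norml; lra.
exists v => // h n hn.
exists (zdiff4 L h - u h).
  have zint (w : heisenberg -> R) : (forall h, m <= hdeg h -> w h \is a Num.int) ->
      (forall h, m <= hdeg h -> zdiff w h \is a Num.int).
    by move=> wint g gm; rewrite rpredB// wint// hdeg_zshift.
  have -> : zdiff4 L h - u h = zdiff4 (fun h => L h - u' h) h.
    by rewrite /zdiff4 iter_zdiffB -u'u.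
  have hm : m <= hdeg h by lia.
  by move: h hm {hn}; do 4!apply/zint.
have gv : green v h - u h - (zdiff4 L h - u h) =
    green v h - psum n.+1 v h - iter n (@avg R) (zdiff4 e) h / 2.
  suff -> : zdiff4 L h = psum n.+1 v h + iter n (@avg R) (zdiff4 e) h / 2 by ring.
  have -> : psum n.+1 v h = psum n.+1 (rho_op L) h - psum n.+1 e h.
    by rewrite -psumB; congr (psum _ _ _); apply/funext => g; rewrite /e; ring.
  have Lvan : vanish (fun i => i < m) L by move=> g; exact: L0.
  have evan : vanish (fun i => i != m) e by move=> g; exact: e0.
  (* From degree m + n, the n + 1 steps of the remainder lead to level m - 1, where [L] vanishes. *)
  rewrite psum_rho_op (iter_avg_vanish (zdiff4_vanish Lvan)); last by rewrite hn; lia.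
  (* Of the terms i <= n for [e], only i = n reaches level m. *)
  rewrite psumS /psum big1 => [|i _]; first by ring.
  rewrite (iter_avg_vanish (zdiff4_vanish evan)) ?mul0r//.
  by have := ltn_ord i; rewrite hn; lia.
rewrite gv; have := tail _ _ n.+1 h vB; have := CB _ _ n h eB.
rewrite mulr1.
have : C / n.+2%:R <= C / n.+1%:R.
  by rewrite ler_wpM2l// lef_pV2 ?posrE ?ltr0n// ler_nat.
rewrite [C * 2]mulrC -!mulrA.
move: (C / n.+2%:R) (C / n.+1%:R) (iter n _ _ _) => A B D.
by rewrite !ler_norml; lra.
Qed.

End Lift.

(** * The circle R/Z *)

Section Circle.
Variable R : realType.

Definition to_circle (x : R) : circle R := (\pi_(Quotient.quot (integers R)) x)%qT.

Lemma to_circleD x y : to_circle (x + y) = to_circle x + to_circle y.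
Proof. exact: (raddfD (\pi_(Quotient.quot (integers R)))%qT). Qed.

Lemma to_circle_eq x y : to_circle x = to_circle y <-> x - y \is a Num.int.
Proof.
have := Quotient.idealrBE (integers R) x y; rewrite -[LHS]/(x - y \is a Num.int) => ->.
by split=> [xy|/eqP//]; apply/eqP; exact: xy.
Qed.

Lemma to_circle_surj (q : circle R) : exists x, to_circle x = q.
Proof. by exists (repr (q : Quotient.quot (integers R))); exact: reprK. Qed.

Lemma to_circle_continuous : continuous to_circle.
Proof. exact: pi_continuous. Qed.

(** The preimage of the image is the union of the integer translates of [U]. *)
Lemma to_circle_open (U : set R) : open U -> open (to_circle @` U).
Proof.
move=> oU; rewrite /open /= /quotient_open.
rewrite (_ : _ @^-1` _ = \bigcup_(k : int) [set x | U (x + k%:~R)]).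
  apply: bigcup_open => k _; apply: (@open_comp _ _ (fun x : R => x + k%:~R)) => //.
  by move=> x _; apply: cvgD; [exact: cvg_id|exact: cvg_cst].
apply/seteqP; split=> [x /= [y Uy /to_circle_eq/intrP[k yx]]|x [k _ /= Ux]].
  by exists k => //=; rewrite -yx addrC subrK.
by exists (x + k%:~R) => //; apply/to_circle_eq; rewrite addrAC subrr add0r.
Qed.
End Circle.

(** * Membership in X_f as an explicit equation *)

Section Principal.
Variable R : realType.

Definition heis_poly : {freeg heisenberg / int} :=
  << 2 *g 1%g >> - << gen_x^-1%g >> - << gen_y^-1%g >>.

Lemma principal_heis_polyP (x : heisenberg -> circle R) :
  principal heis_poly x <-> forall h, x h + x h = x (xpred h) + x (ypred h).
Proof.
set X := (gen_x^-1)%g; set Y := (gen_y^-1)%g.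
have nX1 : X != 1%g.
  apply/eqP => /(congr1 heis_a); rewrite /X heis_gen_xV heisE heis1E; lia.
have nY1 : Y != 1%g.
  apply/eqP => /(congr1 heis_b); rewrite /Y heis_gen_yV heisE heis1E; lia.
have nXY : X != Y.
  apply/eqP => /(congr1 heis_a); rewrite /X /Y heis_gen_xV heis_gen_yV !heisE; lia.
pose neqE := (negbTE nX1, negbTE nY1, negbTE nXY,
  etrans (eq_sym _ _) (negbTE nX1), etrans (eq_sym _ _) (negbTE nY1),
  etrans (eq_sym _ _) (negbTE nXY)).
have cE g : coeff g heis_poly = 2 * (1%g == g)%:R - (X == g)%:R - (Y == g)%:R.
  by rewrite /heis_poly !coeffB !coeffU !mul1r.
have domE : perm_eq (dom heis_poly) [:: 1%g; X; Y].
  apply: uniq_perm; first exact: uniq_dom.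
    by rewrite /= !inE !neqE.
  move=> g; rewrite mem_dom cE !inE ![g == _]eq_sym.
  have [<-|_] := eqVneq 1%g g; first by rewrite !neqE.
  have [<-|_] := eqVneq X g; first by rewrite !neqE.
  by have [_|_] := eqVneq Y g.
have rhoE h : rho heis_poly x h = x h + x h - (x (xpred h) + x (ypred h)).
  have mulzE (y : heisenberg -> circle R) (m : int) l : (y *~ m) l = y l *~ m.
    by case: m => n; rewrite ?NegzE ?mulrNz -?pmulrn ?fctE ?natmulfctE.
  rewrite /rho (perm_big _ domE) /= !big_cons big_nil /= !fctE !mulzE /right_shift !cE.
  rewrite !eqxx !neqE mulg1.
  rewrite mulr1 !mulr0 !subr0 !sub0r !mulrNz !mulr1z addr0 opprD.
  by rewrite -[2]/(Posz 2) -pmulrn mulr2n.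
rewrite /principal /=; split=> [x0 h|xh].
  by apply: subr0_eq; rewrite -rhoE x0.
by apply/funext => h; rewrite rhoE xh subrr.
Qed.

Definition circle_fun (r : heisenberg -> R) : {ptws heisenberg -> circle R} :=
  fun h => to_circle (r h).

Lemma principal_circle_fun (r : heisenberg -> R) :
  principal heis_poly (circle_fun r) <-> forall h, rho_op r h \is a Num.int.
Proof.
have rho_opE' h : rho_op r h = r h + r h - (r (xpred h) + r (ypred h)).
  by rewrite /rho_op; ring.
apply: iff_trans (principal_heis_polyP _) _.
by split=> H h; have := H h; rewrite rho_opE' -!to_circleD => /to_circle_eq.
Qed.

Definition principal_of (r : heisenberg -> R)
    (r_int : forall h, rho_op r h \is a Num.int) :
    principal (R:=R) heis_poly :=
  exist _ (circle_fun r) (mem_set ((principal_circle_fun r).2 r_int)).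
End Principal.

(** * Compactness of the full shift *)

Section FiniteCylinders.
Let T := {ptws heisenberg -> discrete_topology 'I_2}.

Lemma cylinder_nbhs (K : {fset heisenberg}) (v : T) : nbhs v [set w : T | {in K, v =1 w}].
Proof.
have : nbhs v (\bigcap_(k in [set` K]) [set w : T | w k = v k]).
  apply: filter_bigI => k _.
  have := @proj_continuous _ (fun _ : heisenberg => discrete_topology 'I_2) k v.
  by move=> /(_ [set v k] (discrete_set1 _)).
by apply: filterS => w /= wv k /wv ->.
Qed.

Lemma finite_cylinder_cover (K : T -> {fset heisenberg}) :
  exists s : {fset T}, forall w : T, exists2 v, v \in s & {in K v, v =1 w}.
Proof.
have cT : compact [set: T].
  have := @tychonoff _ (fun _ : heisenberg => discrete_topology 'I_2) (fun=> setT).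
  rewrite (_ : [set f | _] = setT); last by apply/seteqP; split.
  apply=> _; apply: finite_compact; exact: finite_finset.
(* Compactness is used in its near-covering form, along the filter of finite sets containing a given
   one. *)
pose F : set_system {fset T} := filter_from [set: {fset T}]
  (fun s : {fset T} => [set s' : {fset T} | {subset s <= s'}]).
have FF : Filter F.
  apply: filter_from_filter; first by exists fset0.
  move=> s t _ _; exists (s `|` t)%fset => // s' sub; split=> k ks; apply: sub;
    by rewrite in_fsetU ks ?orbT.
have := (compact_near_coveringP _).1 cT _ F
  (fun (s : {fset T}) (w : T) => exists2 v, v \in s & {in K v, v =1 w}) FF.
case=> [v _|s _ /(_ s)]; last by move=> H; exists s => w; exact: H.
exists ([set w : T | {in K v, v =1 w}], [set s : {fset T} | v \in s]).
  split; first exact: cylinder_nbhs.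
  by exists [fset v]%fset => // s; apply; rewrite in_fset1.
by move=> [w s] /= [vw vs]; exists v.
Qed.
End FiniteCylinders.

(** * The covering map from the full shift onto X_f *)

Section Cover.
Variable R : realType.
Let T := {ptws heisenberg -> discrete_topology 'I_2}.
Let S := full_shift heisenberg (isT : (1 < 2)%N).
Let f := heis_poly.

Definition digits (v : T) : heisenberg -> R := fun h => (nat_of_ord (v h))%:R.

Lemma digits_bounded v : bounded_by 1 (digits v).
Proof.
move=> h; rewrite /digits ger0_norm// (ler_nat R _ 1).
by rewrite -ltnS ltn_ord.
Qed.

Lemma zdiff4_digits_int v h : zdiff4 (digits v) h \is a Num.int.
Proof.
have zint (w : heisenberg -> R) : (forall h, w h \is a Num.int) ->
    (forall h, zdiff w h \is a Num.int) by move=> wint g; rewrite rpredB.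
by do 4!apply/zint; move: h => _ h; exact: rpred_nat.
Qed.

(** Applying f cancels f^-1 and leaves (1 - z)^4 of an integer configuration; this places the image
    in X_f. *)
Lemma rho_op_green_digits_int v h : rho_op (green (digits v)) h \is a Num.int.
Proof. by rewrite (rho_op_green h (digits_bounded v)); exact: zdiff4_digits_int. Qed.

Definition principal_cover (v : T) : principal (R:=R) f :=
  principal_of (rho_op_green_digits_int v).

Definition cover_map (v : S) : principal (R:=R) f := principal_cover (val v).

(* The tail of the Green series is uniformly small, so up to epsilon finitely
   many coordinates of [v] determine [green (digits v) h]. *)
Lemma green_digits_near (e : R) (v : T) h : 0 < e ->
  exists K : {fset heisenberg}, forall w : T, {in K, v =1 w} ->
    `|green (digits v) h - green (digits w) h| < e.
Proof.
move=> e0; have [C C0 [_ tail]] := psum_tail R.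
have e0' : 0 < e / (2 * C + 1) by rewrite divr_gt0// ltr_wpDl// mulr_ge0.
have [N _ /(_ N (leqnn _))/=] := near_infty_natSinv_lt (PosNum e0').
rewrite /= ltr_pdivlMr ?ltr_wpDl ?mulr_ge0// => Ne.
have [K HK] := local_psum R N h; exists K => w vw.
have vw_psum : psum N (digits v) h = psum N (digits w) h.
  by apply: HK => k kK; rewrite /digits vw.
have := tail _ _ N h (digits_bounded v); have := tail _ _ N h (digits_bounded w).
rewrite vw_psum mulr1; move: Ne.
have : 0 < N.+1%:R^-1 :> R by rewrite invr_gt0 ltr0n.
move: (green (digits v) h) (green (digits w) h) (psum _ _ _) (N.+1%:R^-1 : R).
by move=> a b p q; rewrite !ler_norml !ltr_norml; lra.
Qed.

Lemma continuous_to_principal (X : topologicalType) (g : X -> principal (R:=R) f) :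
  (forall h, continuous (fun x => (val (g x) : {ptws heisenberg -> circle R}) h)) ->
  continuous g.
Proof.
move=> gc; apply: continuous_comp_initial => x.
by apply/cvg_sup => h; apply: continuous_comp_initial; exact: gc.
Qed.

Lemma principal_cover_continuous : continuous principal_cover.
Proof.
apply: continuous_to_principal => h.
have gc : continuous (fun v : T => green (digits v) h).
  move=> v U /nbhs_ballP[e e0 eU].
  have [K HK] := green_digits_near v h e0.
  by apply: filterS (cylinder_nbhs K v) => w /HK vw; apply: eU.
by move=> v; apply: continuous_comp; [exact: gc|exact: to_circle_continuous].
Qed.

Lemma principal_cover_equivariant g v :
  principal_cover (left_shift g v) = alpha g (principal_cover v).
Proof.
apply: val_inj; apply/funext => h /=; rewrite /left_shift /circle_fun.
by rewrite -green_translate.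
Qed.

Lemma dist_int_eps (x : R) : x \isn't a Num.int ->
  exists2 e : R, 0 < e & forall k, k \is a Num.int -> e <= `|x - k|.
Proof.
move=> xN; set n := Num.floor x.
have := floor_itv x; rewrite -/n intrD => /andP[nx xn].
have nx' : n%:~R < x.
  rewrite lt_neqAle nx andbT; apply/eqP => xE.
  by move: xN; rewrite -xE intr_int.
exists (Num.min (x - n%:~R) (n%:~R + 1 - x)).
  by rewrite lt_min !subr_gt0 nx' xn.
move=> _ /intrP[k ->]; rewrite ge_min.
have [kn|kn] := leP k n.
  have : k%:~R <= n%:~R :> R by rewrite ler_int.
  move=> kn'; rewrite ger0_norm ?subr_ge0; last by lra.
  by apply/orP; left; lra.
have : (n + 1)%:~R <= k%:~R :> R by rewrite ler_int; lia.
rewrite intrD => kn'; rewrite ltr0_norm ?subr_lt0; last by lra.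
by apply/orP; right; lra.
Qed.

(** If [x] is missed, each [v] has a site where its image differs from [x] by a definite amount, and
    so does every configuration agreeing with [v] on a finite window. Finitely many [v] suffice by
    compactness, and an approximate preimage accurate at their finitely many sites contradicts
    this. *)
Lemma green_digits_surj (x : heisenberg -> circle R) : principal f x ->
  exists v : T, circle_fun (green (digits v)) = x.
Proof.
move=> xf; apply: contrapT => /forallNP noV.
have /choice[u uP] : forall h, exists y : R, to_circle y = x h.
  by move=> h; exact: to_circle_surj.
have uint h : rho_op u h \is a Num.int.
  suff xu : x = circle_fun u by move: h; apply/principal_circle_fun; rewrite -xu.
  by apply/funext => g; rewrite /circle_fun uP.
have [C C0 approx] := green_approx R.
have /choice[w wP] : forall v : T, exists q : {fset heisenberg} * (heisenberg * R),
   0 < q.2.2 /\ forall v' : T, {in q.1, v =1 v'} -> forall k, k \is a Num.int ->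
     q.2.2 <= `|green (digits v') q.2.1 - u q.2.1 - k|.
  move=> v; have [h hP] : exists h, green (digits v) h - u h \isn't a Num.int.
    apply: contrapT => /forallNP H; apply: (noV v); apply/funext => h.
    rewrite /circle_fun -uP; apply/to_circle_eq.
    by apply: contrapT => /negP/H.
  have [e e0 He] := dist_int_eps hP.
  have e20 : 0 < e / 2 by rewrite divr_gt0.
  have [K HK] := green_digits_near v h e20.
  exists (K, (h, e / 2)); split => //= v' /HK.
  move=> vv' k /He; rewrite (_ : green (digits v) h - u h - k =
    (green (digits v) h - green (digits v') h) +
    (green (digits v') h - u h - k)); last by ring.
  move=> ke; have := ler_normD (green (digits v) h - green (digits v') h)
    (green (digits v') h - u h - k).
  by move: vv' ke; lra.
have [s sP] := finite_cylinder_cover (fun v => (w v).1).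
have /choice[N NP] : forall v : T, exists n : nat, C / n.+1%:R < (w v).2.2.
  move=> v; have [e0 _] := wP v.
  have e0' : 0 < (w v).2.2 / (C + 1) by rewrite divr_gt0// ltr_wpDl.
  have [n _ /(_ n (leqnn _))/=] := near_infty_natSinv_lt (PosNum e0').
  rewrite /= ltr_pdivlMr ?ltr_wpDl// => ne; exists n.
  by rewrite (le_lt_trans _ ne)// mulrC ler_wpM2l ?lerDl.
(* The base level lies far enough below all test sites for the error C / (n + 1) to beat each
   tolerance. *)
have [m mP] : exists m : int, forall v, v \in (s : seq T) -> m + (N v)%:Z <= hdeg (w v).2.1.
  elim: (s : seq T) => [|v t [m IH]]; first by exists 0.
  exists (Num.min m (hdeg (w v).2.1 - (N v)%:Z)) => v'.
  rewrite inE => /predU1P[->|/IH]; lia.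
have [v' v'01 v'P] := approx u uint m.
pose v : T := fun h => if v' h == 1 then 1 else 0.
have dv : digits v = v'.
  apply/funext => h; rewrite /digits /v.
  by case: (v'01 h) => ->; rewrite ?eqxx// eq_sym oner_eq0.
have [v0 v0s v0v] := sP v.
have [e0 /(_ v v0v) far] := wP v0; have := mP v0 v0s; have := NP v0.
set h := (w v0).2.1 in far *; move=> Ne hm.
have [k kint] := v'P h `|hdeg h - m|%N ltac:(lia).
rewrite leNgt => /negP; apply; rewrite -dv (lt_le_trans _ (far k kint))//.
rewrite (le_lt_trans _ Ne)// ler_wpM2l// lef_pV2 ?posrE ?ltr0n// ler_nat; lia.
Qed.

Lemma principal_cover_surj x : exists v, principal_cover v = x.
Proof.
by have [v vx] := green_digits_surj (set_valP x); exists v; exact: val_inj.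
Qed.

Lemma full_shift_symbolic_cover : symbolic_cover R f S.
Proof.
exists cover_map; split.
- move=> v; apply: (@continuous_comp _ _ _ (val : S -> T) principal_cover).
    exact: initial_continuous.
  exact: principal_cover_continuous.
- apply/seteqP; split=> // x _; have [v <-] := principal_cover_surj x.
  by exists (exist _ v (mem_set I)).
- by move=> g v; exact: principal_cover_equivariant.
Qed.

End Cover.

(** * Finite patterns and cylinder neighbourhoods *)

Section Patterns.
Variables (A : Type) (a0 : A) (F : {fset heisenberg}).

Definition pattern_ext (q : {ffun F -> A}) (h : heisenberg) : A :=
  if insub h is Some g then q g else a0.

Lemma pattern_ext_val q (g : F) : pattern_ext q (val g) = q g.
Proof. by rewrite /pattern_ext valK. Qed.

Lemma pattern_ext_notin q h : h \notin F -> pattern_ext q h = a0.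
Proof. by rewrite /pattern_ext => hF; rewrite insubN. Qed.
End Patterns.

Section CylinderBasis.
Let T := {ptws heisenberg -> discrete_topology 'I_2}.

Lemma nbhs_cylinder (v : T) (U : set T) : nbhs v U ->
  exists K : {fset heisenberg}, [set w : T | {in K, v =1 w}] `<=` U.
Proof.
pose G : set_system T := filter_from [set: {fset heisenberg}]
  (fun K : {fset heisenberg} => [set w : T | {in K, v =1 w}]).
have FG : Filter G.
  apply: filter_from_filter; first by exists fset0.
  move=> K L _ _; exists (K `|` L)%fset => // w vw; split=> k kK; apply: vw;
    by rewrite in_fsetU kK ?orbT.
have Gv : G --> v.
  apply/cvg_sup => i W [? [[V oV <-] Vv sub]].
  exists [fset i]%fset => // w vw; apply: sub; rewrite /= /proj.
  by rewrite -(vw i) ?in_fset1.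
by move=> /Gv [K _ KU]; exists K.
Qed.
End CylinderBasis.

(** * Lower bound for the entropy *)

Section Lower.
Variable R : realType.
Let X := principal (R:=R) heis_poly.

(** With radius 1/4, no open arc contains two points differing by exactly 1/2. *)
Definition arc_cover : set (set X) :=
  [set U | exists t : R, U = [set x : X |
     (to_circle (R:=R) @` ball t (4^-1)) ((val x : {ptws heisenberg -> circle R}) 1%g)]].

Lemma arc_cover_open : open_cover arc_cover.
Proof.
split=> [U [t ->]|].
  apply: (@open_comp X _ (fun x : X => (val x : {ptws heisenberg -> circle R}) 1%g)).
    move=> x _; apply: (@continuous_comp X {ptws heisenberg -> circle R} _ val
      (@proj heisenberg (fun=> circle R) 1%g)).
      exact: initial_continuous.
    exact: proj_continuous.
  exact: to_circle_open (ball_open _ _).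
apply/seteqP; split=> // x _.
have [t tx] := to_circle_surj ((val x : {ptws heisenberg -> circle R}) 1%g).
eexists; first by exists t; reflexivity.
by exists t => //=; exact: ballxx.
Qed.

Lemma arc_cover_separates (F : {fset heisenberg}) (V : set X) (x y : X) (g : heisenberg)
    (a b : R) :
  cover_join (@alpha R _ heis_poly) F arc_cover V -> V x -> V y -> g \in F ->
  to_circle a = (val x : heisenberg -> circle R) g ->
  to_circle b = (val y : heisenberg -> circle R) g ->
  a - b = 2^-1 -> False.
Proof.
move=> [c cC <-] Vx Vy gF ax by_g ab.
have [t cg] := cC g gF.
(* Coordinate g of [alpha g w] is coordinate 1 of [w], so [c g] constrains coordinate g. *)
have coord z : (alpha g @` c g) z ->
    exists2 s : R, to_circle s = (val z : heisenberg -> circle R) g & `|t - s| < 4^-1.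
  move=> [w]; rewrite cg => -[s ts sw] <-; exists s; last first.
    by move: ts; rewrite -ball_normE.
  by rewrite sw /= /left_shift mulVg.
have [s1 s1x ts1] := coord x (Vx g gF); have [s2 s2y ts2] := coord y (Vy g gF).
(* This integer would lie strictly between -1 and 0. *)
have : s1 - s2 - 2^-1 \is a Num.int.
  rewrite -ab (_ : _ - _ = (s1 - a) - (s2 - b)); last by ring.
  by rewrite rpredB//; apply/to_circle_eq; rewrite ?s1x ?s2y.
move=> /intrP[k ek].
have : (-1 < k)%R by rewrite -(ltr_int R) -ek; move: ts1 ts2; rewrite !ltr_norml; lra.
have : (k < 0)%R by rewrite -(ltr_int R) -ek; move: ts1 ts2; rewrite !ltr_norml; lra.
lia.
Qed.

(* Points of X_f that vanish below the levels of [F]; above, the choice of one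
   of the two halves of the sum is dictated by [q]. *)
Lemma pattern_points (F : {fset heisenberg}) :
  exists r : {ffun F -> bool} -> heisenberg -> R,
  (forall q h, rho_op (r q) h \is a Num.int) /\
  forall p q, p != q ->
    exists2 g, g \in F & r p g - r q g = 2^-1 \/ r q g - r p g = 2^-1.
Proof.
have [m mF] : exists m : int, forall g, g \in F -> m < hdeg g.
  suff [m mP] : exists m : int, forall g, g \in (F : seq heisenberg) -> m < hdeg g by exists m.
  elim: (F : seq heisenberg) => [|g t [m IH]]; first by exists 0.
  exists (Num.min m (hdeg g - 1)) => g'.
  rewrite inE => /predU1P[->|/IH]; lia.
pose r (q : {ffun F -> bool}) := level_rec m (fun=> 0 : R)
  (fun h a b => (a + b + (pattern_ext false q h)%:R) / 2).
have rB q h : hdeg h <= m -> r q h = 0 by exact: level_rec_base.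
have rS q h : m < hdeg h ->
    r q h = (r q (xpred h) + r q (ypred h) + (pattern_ext false q h)%:R) / 2.
  exact: level_rec_step.
exists r; split=> [q h|p q pq].
  have [hm|hm] := leP (hdeg h) m.
    rewrite /rho_op (rB q h hm) (rB q (xpred h)) ?(rB q (ypred h)).
    - by rewrite mulr0 !subr0.
    - by rewrite hdeg_ypred; lia.
    - by rewrite hdeg_xpred; lia.
  rewrite /rho_op (rS q h hm) (_ : _ - _ = (pattern_ext false q h)%:R); last by field.
  exact: rpred_nat.
(* With no separating site, induction on the level shows that the two points and the two patterns
   agree. *)
apply: contrapT => noG.
suff eqr h : r p h = r q h /\ (m < hdeg h -> pattern_ext false p h = pattern_ext false q h).
  move/eqP: pq; apply; apply/ffunP => g.
  by rewrite -!(pattern_ext_val false) (proj2 (eqr (val g)) (mF _ (valP g))).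
elim/(@level_ind m) : h => h hm => [|[eqx _] [eqy _]].
  by split; [rewrite !rB|rewrite ltNge hm].
suff eqh : pattern_ext false p h = pattern_ext false q h.
  by split=> //; rewrite (rS p h hm) (rS q h hm) eqx eqy eqh.
have [hF|hF] := boolP (h \in F); last by rewrite !pattern_ext_notin.
apply: contrapT => neq; apply: noG; exists h => //.
rewrite (rS p h hm) (rS q h hm) eqx eqy.
move: neq; case: (pattern_ext _ p h) (pattern_ext _ q h) => -[]// _.
  by left=> /=; field.
by right=> /=; field.
Qed.

(** The 2^|F| pattern points lie in pairwise distinct members of any subcover. *)
Lemma arc_cover_number (F : {fset heisenberg}) :
  ((ln (2 : R) * #|` F|%:R)%:E <=
   log_cover_number R (cover_join (@alpha R _ heis_poly) F arc_cover))%E.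
Proof.
apply: le_ereal_inf_tmp => _ [n [D [DC Dn Dcov]] <-].
have [r [rint rsep]] := pattern_points F.
pose pt q : X := principal_of (rint q).
have /choice[d dP] : forall q, exists U, D U /\ U (pt q).
  move=> q; have : (\bigcup_(U in D) U) (pt q) by rewrite Dcov.
  by move=> [U DU Uq]; exists U.
have /card_set_bijP[phi [phi_in phi_inj _]] := Dn.
pose idx q : 'I_n := Ordinal (phi_in _ (proj1 (dP q))).
have idx_inj : injective idx.
  move=> p q /(congr1 val)/= /phi_inj; rewrite !inE => /(_ (proj1 (dP p)) (proj1 (dP q))) dpq.
  apply/eqP/negP => /negP/rsep[g gF].
  have Up := (dP p).2; have Uq := (dP q).2; rewrite -dpq in Uq.
  have join := DC _ (proj1 (dP p)).
  case=> /[dup] ab.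
    exact: (arc_cover_separates join Up Uq gF erefl erefl).
  exact: (arc_cover_separates join Uq Up gF erefl erefl).
have := leq_card _ idx_inj; rewrite card_ffun card_bool card_ord -cardfE => Fn.
rewrite lee_fin mulrC mulr_natl -lnXn// -natrX ler_ln ?posrE ?ltr0n ?expn_gt0//.
  by rewrite ler_nat.
by apply: leq_trans Fn; rewrite expn_gt0.
Qed.
End Lower.

(** * Upper bound for the entropy, and conclusion *)

Section Upper.
Variable R : realType.
Let T := {ptws heisenberg -> discrete_topology 'I_2}.
Let X := principal (R:=R) heis_poly.

Definition rtrans (F : {fset heisenberg}) (k : heisenberg) : {fset heisenberg} :=
  [fset (h * k)%g | h in F]%fset.

Definition thicken (F : {fset heisenberg}) (K : seq heisenberg) : {fset heisenberg} :=
  \big[fsetU/fset0]_(k <- K) rtrans F k.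

(** The symmetric difference whose relative size tends to 0 in [folner]. *)
Definition boundary (F : {fset heisenberg}) (k : heisenberg) : {fset heisenberg} :=
  ((F `\` rtrans F k) `|` (rtrans F k `\` F))%fset.

Lemma thicken_mem F (K : seq heisenberg) g k :
  g \in F -> k \in K -> (g * k)%g \in thicken F K.
Proof.
move=> gF; rewrite /thicken; elim: K => // k' K IH; rewrite inE big_cons in_fsetU.
move=> /predU1P[->|/IH ->]; rewrite ?orbT// (_ : _ \in rtrans F _)//.
by apply/imfsetP; exists g.
Qed.

Lemma card_thicken F (K : seq heisenberg) :
  (#|` thicken F K| <= #|` F| + \sum_(k <- K) #|` boundary F k|)%N.
Proof.
(* With F included in the union, each k adds at most the points of F k outside F. *)
suff : (#|` (F `|` thicken F K)%fset| <= #|` F| + \sum_(k <- K) #|` boundary F k|)%N.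
  by apply: leq_trans; exact: fsubset_leq_card (fsubsetUr _ _).
elim: K => [|k K IH]; first by rewrite /thicken !big_nil fsetU0 addn0.
rewrite [X in (_ <= _ + X)%N]big_cons addnCA (leq_trans _ (leq_add (leqnn _) IH))//.
rewrite (leq_trans _ (leq_card_fsetU _ _))// fsubset_leq_card//.
apply/fsubsetP => g; rewrite /thicken big_cons !in_fsetU !in_fsetD.
by case: (g \in F) (g \in rtrans F k) (g \in \bigcup_(_ <- _) _)%fset => [] [] [].
Qed.

(** Symbolic form of a Lebesgue number: by compactness one window [K] serves all [w]. *)
Lemma open_cover_patterns (C : set (set X)) : open_cover C ->
  exists K : {fset heisenberg}, forall w : T, exists2 U, C U &
    forall w' : T, {in K, w =1 w'} -> U (principal_cover R w').
Proof.
move=> [Co Ccov].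
have /choice[U UP] : forall v : T, exists U, C U /\ U (principal_cover R v).
  move=> v; have : (\bigcup_(U in C) U) (principal_cover R v) by rewrite Ccov.
  by move=> [U CU Uv]; exists U.
have /choice[K KP] : forall v : T, exists K : {fset heisenberg},
    forall w : T, {in K, v =1 w} -> U v (principal_cover R w).
  move=> v; have [CU Uv] := UP v.
  have : nbhs v (principal_cover R @^-1` U v).
    by apply: principal_cover_continuous; apply: open_nbhs_nbhs; split => //; exact: Co.
  by move=> /nbhs_cylinder[K KU]; exists K.
have [s sP] := finite_cylinder_cover K.
exists (\big[fsetU/fset0]_(v <- s) K v)%fset => w.
have [v vs vw] := sP w; exists (U v); first exact: (UP v).1.
move=> w' ww'; apply: KP => k kK; rewrite vw// ww'//.
have {}vs : v \in (s : seq T) := vs.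
elim: (s : seq T) vs => // v' t IH.
rewrite inE big_cons in_fsetU.
by move=> /predU1P[<-|/IH ->]; rewrite ?kK ?orbT.
Qed.

(** A pattern of [w] on the product set F K selects a member of the join containing the image of
    [w]. By surjectivity these members cover X_f, and there are at most 2^|F K| of them. *)
Lemma cover_number_le (C : set (set X)) : open_cover C ->
  exists K : {fset heisenberg}, forall F,
  (log_cover_number R (cover_join (@alpha R _ heis_poly) F C) <=
   (ln (2 : R) * #|` thicken F K|%:R)%:E)%E.
Proof.
move=> /open_cover_patterns[K KP]; exists K => F.
have /choice[U UP] : forall w : T, exists U, C U /\
    forall w' : T, {in K, w =1 w'} -> U (principal_cover R w').
  by move=> w; have [U CU HU] := KP w; exists U.
set FK := thicken F K.
pose ext (p : {ffun FK -> 'I_2}) : T := pattern_ext ord0 p.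
pose E p : set X := \bigcap_(g in [set` F]) (alpha g @` U (left_shift g^-1%g (ext p))).
pose D : set (set X) := range E.
have Dcov : \bigcup_(V in D) V = setT.
  apply/seteqP; split => // x _; have [w <-] := principal_cover_surj x.
  pose p : {ffun FK -> 'I_2} := [ffun g : FK => w (val g)].
  exists (E p); first by exists p.
  move=> g /= gF; exists (principal_cover R (left_shift g^-1%g w)).
    apply: (UP _).2 => k kK; rewrite /left_shift /ext invgK.
    have gk := thicken_mem gF kK.
    by have := pattern_ext_val ord0 p [` gk]%fset; rewrite ffunE /= => ->.
  rewrite -principal_cover_equivariant; congr principal_cover.
  by apply/funext => h; rewrite /left_shift invgK mulVKg.
have DC : D `<=` cover_join (@alpha R _ heis_poly) F C.
  move=> _ [p _ <-]; exists (fun g => U (left_shift g^-1%g (ext p))) => //.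
  by move=> g _; exact: (UP _).1.
have [n Dn] : exists n, (D #= `I_n)%card.
  by apply/finite_setP; apply: finite_image; exact: finite_finset.
apply: ge_ereal_inf; exists (ln (n%:R : R))%:E; first by exists n => //; exists D.
have np : (n <= 2 ^ #|` FK|)%N.
  have /card_set_bijP[phi [_ _ phi_surj]] := Dn.
  have /choice[p pP] : forall i : 'I_n, exists p, phi (E p) = i.
    move=> i; have [_ [p _ <-] pi] := phi_surj i (ltn_ord i).
    by exists p.
  have p_inj : injective p by move=> i j pij; apply: val_inj; rewrite /= -!pP pij.
  by have := leq_card _ p_inj; rewrite card_ord card_ffun card_ord -cardfE.
rewrite lee_fin mulrC mulr_natl -lnXn// -natrX.
(* For n = 0 the convention ln 0 = 0 applies. *)
case: n np {Dn} => [_|n np]; first by rewrite ln0// ln_ge0// ler1n expn_gt0.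
by rewrite ler_ln ?posrE ?ltr0n ?expn_gt0// ler_nat.
Qed.

Lemma folner_card_gt0 (F : nat -> {fset heisenberg}) n :
  folner R F -> 0 < #|` F n|%:R :> R.
Proof. by move=> [/(_ n) F0 _]; rewrite ltr0n cardfs_gt0. Qed.

(** For every open cover the Folner condition gives |F K| / |F| --> 1, hence the bound log 2; for
    [arc_cover] the quotient is squeezed between log 2 and this bound. *)
Lemma principal_entropy (F : nat -> {fset heisenberg}) : folner R F ->
  topological_entropy R F (@alpha R _ heis_poly) = (ln (2 : R))%:E.
Proof.
move=> FF; have [_ Fb] := FF.
have ln2 : 0 <= ln (2 : R) by rewrite ln_ge0// ler1n.
pose a C n := (log_cover_number R (cover_join (@alpha R _ heis_poly) (F n) C)
  * (#|` F n|%:R^-1)%:E)%E.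
have inv0 n : (0 <= (#|` F n|%:R^-1 : R)%:E)%E.
  by rewrite lee_fin invr_ge0 ltW// folner_card_gt0.
have upper C : open_cover C -> exists2 b : nat -> \bar R,
    (forall n, (a C n <= b n)%E) & b @ \oo --> (ln (2 : R))%:E.
  move=> /cover_number_le[K KP].
  pose b n := ln (2 : R) * (1 + \sum_(k <- K) #|` boundary (F n) k|%:R / #|` F n|%:R).
  exists (EFin \o b) => [n|].
    apply: le_trans (lee_wpmul2r (inv0 n) (KP (F n))) _.
    rewrite -EFinM lee_fin -mulrA ler_wpM2l// ler_pdivrMr ?folner_card_gt0//.
    rewrite mulrDl mul1r -mulr_suml mulfVK ?gt_eqF ?folner_card_gt0//.
    by rewrite -natr_sum -natrD ler_nat; exact: card_thicken.
  apply: cvg_EFin; first exact: nearW.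
  rewrite [fine \o _](_ : _ = b)// -[X in _ --> X]mulr1.
  apply: cvgMr; rewrite -[X in _ --> X]addr0; apply: cvgD; first exact: cvg_cst.
  rewrite -[X in _ --> X](@big1_eq R 0 +%R _ K xpredT).
  by apply: cvg_big => [|k _]; [exact: add_continuous|exact: Fb].
apply/le_anti/andP; split.
  apply: ge_ereal_sup => _ [C Cc <-]; have [b ab bl] := upper C Cc.
  (* A divergent sequence has the default limit 0, which is below log 2. *)
  have [cv|dv] := pselect (cvgn (a C)); last by rewrite (dvgP dv) lee_fin.
  rewrite -(cvg_lim (@ereal_hausdorff R) bl); apply: lee_lim => //.
    by apply/cvg_ex; eexists; exact: bl.
  exact: nearW.
apply: le_ereal_sup_tmp; exists (limn (a (@arc_cover R))).
  by exists (@arc_cover R) => //; exact: arc_cover_open.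
have [b ab bl] := upper _ (arc_cover_open R).
rewrite le_eqVlt; apply/orP; left; apply/eqP/esym/cvg_lim => //.
apply: squeeze_cvge (cvg_cst _) bl; apply: nearW => n; rewrite ab andbT.
apply: le_trans (lee_wpmul2r (inv0 n) (arc_cover_number R (F n))).
by rewrite -EFinM lee_fin mulfK// gt_eqF// folner_card_gt0.
Qed.

Lemma full_shift_entropy (F : nat -> {fset heisenberg}) : folner R F ->
  subshift_entropy R F (full_shift heisenberg (isT : (1 < 2)%N)) = (ln (2 : R))%:E.
Proof.
move=> FF; apply/cvg_lim => //.
rewrite (_ : (fun n => _) = fun=> (ln (2 : R))%:E); first exact: cvg_cst.
apply/funext => n; congr EFin.
have -> : coord_proj (N:=2) (F n) @` full_shift heisenberg (isT : (1 < 2)%N) =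
    [set` [fset p | p : {ffun F n -> 'I_2}]%fset].
  apply/seteqP; split=> [p _|p _]; first by rewrite /= in_imfset.
  exists (pattern_ext ord0 p : T) => //.
  by apply/ffunP => g; rewrite ffunE pattern_ext_val.
rewrite set_fsetK card_imfset// -cardT card_ffun card_ord -cardfE natrX lnXn//.
by rewrite -[ln _ *+ _]mulr_natr mulfK// gt_eqF// folner_card_gt0.
Qed.
End Upper.

Theorem corollary5p9 (R : realType) (F : nat -> {fset heisenberg})
    (F_folner : folner R F) :
  let f : {freeg heisenberg / int} :=
    << 2 *g 1%g >> - << gen_x^-1%g >> - << gen_y^-1%g >> in
  topological_entropy R F (@alpha R heisenberg f) = (ln (2 : R))%:E /\
  equal_entropy_symbolic_cover R F f (full_shift heisenberg (isT : (1 < 2)%N)).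
Proof.
move=> f; rewrite -[f]/heis_poly; split; first exact: principal_entropy.
split; first exact: full_shift_symbolic_cover.
by rewrite principal_entropy// full_shift_entropy.
Qed.
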